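(* Let $R$ be a ring. Then $R$ is a Nil$_{\ast}$-Noetherian ring if and only if the polynomial ring $R[x]$ in one variable over $R$ is a Nil$_{\ast}$-Noetherian ring.
   Context: All rings are commutative with identity. An ideal $I$ of a ring $R$ is a nil ideal if every element of $I$ is nilpotent. A ring $R$ is Nil$_{\ast}$-Noetherian if every nil ideal of $R$ is finitely generated. *)

(* Defs.v *)
From HB Require Import structures.
From mathcomp Require Import all_boot all_algebra.
From mathcomp Require Import classical_sets.

Set Implicit Arguments.
Unset Strict Implicit.
Unset Printing Implicit Defensive.

Import GRing.Theory.

Local Open Scope classical_set_scope.
Local Open Scope ring_scope.

(* Ideals are Prop-valued subsets: the predicate [idealr_closed] of
   ring_quotient.v concerns only decidable, proper ideals.  The base structure
   is the commutative unital ring, without assuming 1 != 0. *)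
Record is_ideal (R : comPzRingType) (I : set R) : Prop := IsIdeal {
  ideal_zero : I 0;
  ideal_add : forall x y : R, I x -> I y -> I (x + y);
  ideal_mul : forall a x : R, I x -> I (a * x)
}.

Definition is_nilpotent (R : comPzRingType) (x : R) : Prop :=
  exists n : nat, x ^+ n = 0.

Definition is_nil_ideal (R : comPzRingType) (I : set R) : Prop :=
  is_ideal I /\ forall x : R, I x -> is_nilpotent x.

Definition ideal_span (R : comPzRingType) (s : seq R) : set R :=
  [set x | exists c : 'I_(size s) -> R, x = \sum_(i < size s) c i * s`_i].

Definition finitely_generated (R : comPzRingType) (I : set R) : Prop :=
  exists s : seq R, I = ideal_span s.

Definition nil_star_noetherian (R : comPzRingType) : Prop :=
  forall I : set R, is_nil_ideal I -> finitely_generated I.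

(* Main.v *)
Require Import Defs.
From HB Require Import structures.
From mathcomp Require Import all_boot all_algebra.
From mathcomp Require Import classical_sets.

(** The nil ideals of R are the submodules of its nilradical, so R is
    Nil_*-Noetherian exactly when its nilradical is a Noetherian R-module, and
    the theorem is Hilbert's basis theorem for this module.

    From R to R[x], let J be a nil ideal of R[x], and let L_n be the ideal of
    the coefficients of x^n of the elements of J of degree at most n
    ([lead_ideal]). The classical proof of the basis theorem only uses finite
    generation of the L_n and of their union L, and these are nil ideals of R:
    the top coefficient of a nilpotent polynomial is nilpotent
    ([lead_nilpotent]). As L is finitely generated and the L_n increase, L =
    L_m for some m ([lead_ideal_stationary]). Finite generation of L_0, ...,
    L_m gives finitely many elements of J that generate those of degree at most
    m ([bounded_degree_span]); an element p of J of degree n > m is brought to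
    a lower degree by subtracting x^(n - m) * q, where q in J has degree at
    most m and q_m = p_n.

    From R[x] to R, a nil ideal I of R gives the ideal I[x] of the polynomials
    with coefficients in I, which is nil because nilpotents form an ideal
    ([nilpotent_ideal]).  The constant terms of generators of I[x] generate
    I. *)

Set Implicit Arguments.
Unset Strict Implicit.
Unset Printing Implicit Defensive.

Import GRing.Theory.
Local Open Scope classical_set_scope.
Local Open Scope ring_scope.

(** * Ideals and their generators *)

Section Ideals.
Variable R : comPzRingType.
Implicit Types (I : set R) (s : seq R).

Lemma ideal_sub I x y : is_ideal I -> I x -> I y -> I (x - y).
Proof.
by move=> idI Ix Iy; rewrite -mulN1r; apply: ideal_add => //; apply: ideal_mul.
Qed.

Lemma ideal_sum I (T : Type) (r : seq T) (F : T -> R) :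
  is_ideal I -> (forall i, I (F i)) -> I (\sum_(i <- r) F i).
Proof.
move=> idI IF; apply: (big_ind I) => //; first exact: ideal_zero.
exact: ideal_add.
Qed.

Lemma ideal_span_ideal s : is_ideal (ideal_span s).
Proof.
split.
- by exists (fun=> 0); rewrite big1 // => i _; rewrite mul0r.
- move=> _ _ [c ->] [d ->]; exists (fun i => c i + d i).
  by rewrite -big_split /=; apply: eq_bigr => i _; rewrite mulrDl.
- move=> a _ [c ->]; exists (fun i => a * c i).
  by rewrite mulr_sumr; apply: eq_bigr => i _; rewrite mulrA.
Qed.

Lemma mem_ideal_span s x : x \in s -> ideal_span s x.
Proof.
move=> sx; have ltxs : (index x s < size s)%N by rewrite index_mem.
exists (fun i => (i == Ordinal ltxs)%:R).
rewrite (bigD1 (Ordinal ltxs)) //= eqxx mul1r nth_index // big1 ?addr0 //.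
by move=> i /negbTE ->; rewrite mul0r.
Qed.

Lemma ideal_span_sub s I :
  is_ideal I -> (forall x, x \in s -> I x) -> ideal_span s `<=` I.
Proof.
move=> idI sI _ [c ->]; apply: ideal_sum => // i.
by apply: ideal_mul => //; apply/sI/mem_nth.
Qed.

Lemma ideal_span_cat s u :
  ideal_span s `<=` ideal_span (s ++ u) /\
  ideal_span u `<=` ideal_span (s ++ u).
Proof.
split; apply: ideal_span_sub (ideal_span_ideal _) _ => x xs;
  by apply: mem_ideal_span; rewrite mem_cat xs ?orbT.
Qed.

(** The exponent m + n works for a sum because every term of the binomial
    expansion then contains x ^+ m or y ^+ n. *)
Lemma nilpotent_ideal : is_ideal [set x : R | is_nilpotent x].
Proof.
split.
- by exists 1%N; rewrite expr1.
- move=> x y [m xm0] [n yn0]; exists (m + n)%N.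
  rewrite exprDn big1 // => i _.
  have [le_ni|lt_in] := leqP n i.
    by rewrite -(subnKC le_ni) exprD yn0 mul0r mulr0 mul0rn.
  have le_m : (m <= m + n - i)%N by rewrite -addnBA ?leq_addr // ltnW.
  by rewrite -(subnKC le_m) exprD xm0 !mul0r mul0rn.
- by move=> a x [n xn0]; exists n; rewrite exprMn xn0 mulr0.
Qed.

End Ideals.

Lemma preimage_ideal (R S : comPzRingType) (f : {rmorphism R -> S})
  (I : set S) : is_ideal I -> is_ideal (f @^-1` I).
Proof.
move=> idI; split; rewrite /preimage /=.
- by rewrite rmorph0; apply: ideal_zero.
- by move=> x y Ix Iy; rewrite rmorphD; apply: ideal_add.
- by move=> a x Ix; rewrite rmorphM; apply: ideal_mul.
Qed.

(** * Ideals of leading coefficients *)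

Section LeadingCoefficients.
Variable R : comNzRingType.
Implicit Types (J : set {poly R}) (n : nat).

(** The degree of p is only bounded by n, so that p`_n may vanish: the leading
    terms of two polynomials may cancel in their sum. *)
Definition lead_ideal J n : set R :=
  [set a | exists2 p : {poly R}, J p & (size p <= n.+1)%N /\ p`_n = a].

Lemma lead_ideal_ideal J n : is_ideal J -> is_ideal (lead_ideal J n).
Proof.
move=> idJ; split.
- by exists 0; [apply: ideal_zero | rewrite size_poly0 coef0].
- move=> _ _ [p Jp [sp <-]] [q Jq [sq <-]]; exists (p + q).
    exact: ideal_add.
  split; last exact: coefD.
  by rewrite (leq_trans (size_polyD _ _)) // geq_max sp sq.
- move=> a _ [p Jp [sp <-]]; exists (a%:P * p); first exact: ideal_mul.
  by rewrite coefCM mul_polyC (leq_trans (size_scale_leq _ _)).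
Qed.

Lemma lead_ideal_sub J K n :
  J `<=` K -> lead_ideal J n `<=` lead_ideal K n.
Proof. by move=> JK a [p /JK Kp pP]; exists p. Qed.

Lemma size_mulXn_leq (p : {poly R}) k n :
  (size p <= n)%N -> (size ('X^k * p)%R <= k + n)%N.
Proof.
move=> sp; rewrite (leq_trans (size_polyMleq _ _)) // size_polyXn /=.
by rewrite leq_add2l.
Qed.

(** Multiplication by 'X^(n - m) moves the coefficient of degree m to n. *)
Lemma lead_ideal_leq J m n :
  is_ideal J -> (m <= n)%N -> lead_ideal J m `<=` lead_ideal J n.
Proof.
move=> idJ le_mn _ [p Jp [sp <-]]; exists ('X^(n - m) * p).
  exact: ideal_mul.
split; first by rewrite -{2}(subnK le_mn) -addnS size_mulXn_leq.
by rewrite coefXnM ltnNge leq_subr /= subKn.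
Qed.

Lemma size_drop_lead (p : {poly R}) n :
  (size p <= n.+1)%N -> p`_n = 0 -> (size p <= n)%N.
Proof.
move=> sp pn0; apply/leq_sizeP => j; rewrite leq_eqVlt => /predU1P[<- //|].
exact: (leq_sizeP _ _ sp).
Qed.

(** In the product of p and p ^+ k, the coefficient of degree n + k * n has only
    one term i = n: the other indices exceed one of the two degree bounds. *)
Lemma coef_exp_lead (p : {poly R}) n k : (size p <= n.+1)%N ->
  (size (p ^+ k) <= (k * n).+1)%N /\ (p ^+ k)`_(k * n) = p`_n ^+ k.
Proof.
move=> sp; elim: k => [|k [IHs IHc]].
  by rewrite !expr0 mul0n size_poly1 coef1.
rewrite exprS mulSn; split.
  rewrite (leq_trans (size_polyMleq _ _)) // -subn1 leq_subLR add1n.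
  by rewrite (leq_trans (leq_add sp IHs)) // addSn addnS.
rewrite coefM.
have lt_n : (n < (n + k * n).+1)%N by rewrite ltnS leq_addr.
rewrite (bigD1 (Ordinal lt_n)) //= addKn IHc -exprS big1 ?addr0 // => i.
rewrite -val_eqE /= neq_ltn => /orP[lt_in|lt_ni].
  rewrite [(p ^+ k)`_ _]nth_default ?mulr0 // (leq_trans IHs) //.
  by rewrite ltn_subRL ltn_add2r.
by rewrite nth_default ?mul0r // (leq_trans sp).
Qed.

Lemma lead_nilpotent (p : {poly R}) n :
  (size p <= n.+1)%N -> is_nilpotent p -> is_nilpotent p`_n.
Proof.
move=> sp [k pk0]; exists k.
by rewrite -(proj2 (coef_exp_lead k sp)) pk0 coef0.
Qed.

Lemma lead_ideal_nil J n : is_nil_ideal J -> is_nil_ideal (lead_ideal J n).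
Proof.
move=> [idJ nilJ]; split; first exact: lead_ideal_ideal.
by move=> _ [p /nilJ nilp [sp <-]]; apply: lead_nilpotent.
Qed.

Lemma lead_ideal_union_nil J :
  is_nil_ideal J -> is_nil_ideal [set a | exists n, lead_ideal J n a].
Proof.
move=> nJ; have [idJ _] := nJ.
split; last by move=> a [n]; apply: (proj2 (lead_ideal_nil n nJ)).
split.
- by exists 0%N; apply: ideal_zero; apply: lead_ideal_ideal.
- move=> a b [m La] [n Lb]; exists (maxn m n).
  apply: ideal_add; first exact: lead_ideal_ideal.
    exact: lead_ideal_leq (leq_maxl _ _) _ La.
  exact: lead_ideal_leq (leq_maxr _ _) _ Lb.
- move=> a b [n Lb]; exists n.
  by apply: ideal_mul; first exact: lead_ideal_ideal.
Qed.

(** Each of the finitely many generators of the union of the [lead_ideal J n]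
    appears at some stage, hence they all belong to a common one. *)
Lemma lead_ideal_stationary J : nil_star_noetherian R -> is_nil_ideal J ->
  exists m, forall n, lead_ideal J n `<=` lead_ideal J m.
Proof.
move=> noethR nJ; have [idJ _] := nJ.
have [s Ls] := noethR _ (lead_ideal_union_nil nJ).
have {noethR} [m sm] : exists m, forall a, a \in s -> lead_ideal J m a.
  have : forall a, a \in s -> exists n, lead_ideal J n a.
    by move=> a /mem_ideal_span; rewrite -Ls.
  elim: s {Ls} => [|b s IHs] sL; first by exists 0%N.
  have [|m sm] := IHs; first by move=> a sa; apply: sL; rewrite inE sa orbT.
  have [n bn] := sL b (mem_head _ _).
  exists (maxn m n) => a; rewrite inE => /predU1P[->|/sm am].
    exact: lead_ideal_leq (leq_maxr _ _) _ bn.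
  exact: lead_ideal_leq (leq_maxl _ _) _ am.
exists m => n a La; have : ideal_span s a by rewrite -Ls; exists n.
by apply: ideal_span_sub => //; apply: lead_ideal_ideal.
Qed.

(** Generators of a subideal of [lead_ideal J n] lift to finitely many elements
    of J, and an ideal containing the lifts has enough leading coefficients,
    because [lead_ideal (ideal_span u) n] is itself an ideal. *)
Lemma lift_lead_span J n (t : seq R) :
  (forall a, a \in t -> lead_ideal J n a) ->
  exists2 u : seq {poly R}, (forall p, p \in u -> J p) &
    ideal_span t `<=` lead_ideal (ideal_span u) n.
Proof.
move=> tL.
suff [u uJ tu] : exists2 u : seq {poly R}, (forall p, p \in u -> J p) &
    forall a, a \in t -> lead_ideal [set` u] n a.
  exists u => //; apply: ideal_span_sub => [|a /tu].
    exact/lead_ideal_ideal/ideal_span_ideal.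
  by apply: lead_ideal_sub => p /=; apply: mem_ideal_span.
elim: t tL => [|b t IHt] tL; first by exists [::].
have [|u uJ tu] := IHt; first by move=> a ta; apply: tL; rewrite inE ta orbT.
have [q Jq qb] := tL b (mem_head _ _).
exists (q :: u) => [p|a]; first by rewrite inE => /predU1P[->|/uJ].
rewrite inE => /predU1P[->|/tu]; first by exists q => //=; apply: mem_head.
by apply: lead_ideal_sub => p /= up; rewrite inE up orbT.
Qed.

(** Only degrees below n matter here, so that the finitely many ideals
    [lead_ideal J i] with i < n, each finitely generated, suffice: generators
    of the last one, lifted to J, cancel the coefficient of degree n - 1. *)
Lemma bounded_degree_span J n : nil_star_noetherian R -> is_nil_ideal J ->
  exists2 s : seq {poly R}, (forall p, p \in s -> J p) &
    forall p, J p -> (size p <= n)%N -> ideal_span s p.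
Proof.
move=> noethR nJ; have [idJ _] := nJ.
elim: n => [|n [s sJ Js]].
  exists [::] => // p _; rewrite leqn0 size_poly_eq0 => /eqP->.
  by apply: ideal_zero; apply: ideal_span_ideal.
have [t Lt] := noethR _ (lead_ideal_nil n nJ).
have [|u uJ tu] := @lift_lead_span J n t.
  by move=> a /mem_ideal_span; rewrite -Lt.
exists (s ++ u) => [p|p Jp sp].
  by rewrite mem_cat => /orP[/sJ|/uJ].
have [|q uq [sq qn]] := tu p`_n; first by rewrite -Lt; exists p.
have [sub_s sub_u] := ideal_span_cat s u.
rewrite -(subrK q p); apply: ideal_add; first exact: ideal_span_ideal.
  have Jq : J q by apply: ideal_span_sub uq.
  apply/sub_s/Js; first exact: ideal_sub.
  apply: size_drop_lead; last by rewrite coefB qn subrr.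
  by rewrite (leq_trans (size_polyD _ _)) // size_polyN geq_max sp sq.
exact: sub_u.
Qed.

End LeadingCoefficients.

(** * Transfer between a ring and its polynomial ring *)

(** The elements of degree at most m are generated by s; above m, the leading
    coefficient comes from degree m, which gives an induction on the degree. *)
Lemma nil_star_noetherian_poly (R : comNzRingType) :
  nil_star_noetherian R -> nil_star_noetherian {poly R}.
Proof.
move=> noethR J nJ; have [idJ _] := nJ.
have [m Lm] := lead_ideal_stationary noethR nJ.
have [s sJ Js] := bounded_degree_span m.+1 noethR nJ.
exists s; apply/seteqP; split; last exact: ideal_span_sub.
suff Jn n p : J p -> (size p <= n)%N -> ideal_span s p.
  by move=> p /Jn; apply.
elim: n p => [|n IHn] p Jp sp; first by apply: Js; rewrite // (leq_trans sp).
have [le_nm|lt_mn] := leqP n m; first by apply: Js; rewrite // (leq_trans sp).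
have [|q Jq [sq qm]] := Lm n p`_n; first by exists p.
have Jxq : J ('X^(n - m) * q) by apply: ideal_mul.
rewrite -(subrK ('X^(n - m) * q) p).
apply: ideal_add; first exact: ideal_span_ideal; last first.
  by apply: ideal_mul; [exact: ideal_span_ideal | exact: Js].
apply: IHn; first exact: ideal_sub.
apply: size_drop_lead.
  rewrite (leq_trans (size_polyD _ _)) // size_polyN geq_max sp /=.
  by rewrite -{2}(subnK (ltnW lt_mn)) -addnS size_mulXn_leq.
by rewrite coefB coefXnM ltnNge leq_subr /= subKn ?qm ?subrr // ltnW.
Qed.

(** Each term of p is nilpotent with its coefficient, and p is their sum. *)
Lemma poly_coefs_nil_ideal (R : comNzRingType) (I : set R) :
  is_nil_ideal I -> is_nil_ideal [set p : {poly R} | forall i, I p`_i].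
Proof.
move=> [idI nilI]; split; first split.
- by move=> i; rewrite coef0; apply: ideal_zero.
- by move=> p q Ip Iq i; rewrite coefD; apply: ideal_add.
- move=> p q Iq i; rewrite coefM; apply: ideal_sum => // j.
  exact: ideal_mul.
move=> p Ip; rewrite -[p]coefK poly_def.
apply: (ideal_sum _ (nilpotent_ideal {poly R})) => i /=.
have [k pk0] := nilI _ (Ip i).
by exists k; rewrite exprZn pk0 scale0r.
Qed.

(** The constant term is a ring morphism, so the polynomials whose constant term
    lies in a given ideal form an ideal; it contains I[x] as soon as it contains
    the generators of I[x], and so its constant polynomials include I. *)
Lemma nil_star_noetherian_of_poly (R : comNzRingType) :
  nil_star_noetherian {poly R} -> nil_star_noetherian R.
Proof.
move=> noethRx I nI; have [idI _] := nI.
have [s Is] := noethRx _ (poly_coefs_nil_ideal nI).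
exists [seq coefp 0 p | p <- s]; apply/seteqP; split => [a Ia|].
  have spanP : ideal_span s a%:P.
    rewrite -Is => i /=; rewrite coefC; case: ifP => // _.
    exact: ideal_zero.
  set t := [seq _ | _ <- _].
  have sub_t : ideal_span s `<=` coefp 0 @^-1` ideal_span t.
    apply: ideal_span_sub => [|p sp].
      exact/preimage_ideal/ideal_span_ideal.
    exact/mem_ideal_span/(map_f (coefp 0)).
  by have := sub_t _ spanP; rewrite /preimage /= coefC.
apply: ideal_span_sub => // _ /mapP[p /mem_ideal_span sp ->].
by move: sp; rewrite -Is; apply.
Qed.

Theorem theorem1p9 (R : comNzRingType) :
  nil_star_noetherian R <-> nil_star_noetherian {poly R}.
Proof.
split; [exact: nil_star_noetherian_poly | exact: nil_star_noetherian_of_poly].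
Qed.
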